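(* Let $\theta$ be a $B$-action and let $(X,d_\theta)$ be a complete $\theta$-metric space. Then $(X,\tau_{d_\theta})$ is completely metrizable, i.e. there is a complete metric on $X$ inducing the topology $\tau_{d_\theta}$.
   Context: A $B$-action is a map $\theta:[0,+\infty)\times[0,+\infty)\to[0,+\infty)$, continuous with respect to each variable, such that, with $\mathrm{Im}(\theta)=\{\theta(s,t):s,t\ge 0\}$: (I) $\theta(0,0)=0$ and $\theta(t,s)=\theta(s,t)$ for all $t,s\ge 0$; (II) $\theta(s,t)<\theta(u,v)$ whenever either $s<u$ and $t\le v$, or $s\le u$ and $t<v$; (III) for each $r\in \mathrm{Im}(\theta)\setminus\{0\}$ and each $s\in(0,r]$ there exists $t\in[0,r]$ with $\theta(t,s)=r$; (IV) $\theta(s,0)\le s$ for all $s>0$. A $\theta$-metric on a nonempty set $X$ is a map $d_\theta:X\times X\to[0,+\infty)$ such that for all $x,y,z\in X$: $d_\theta(x,y)=0$ iff $x=y$; $d_\theta(x,y)=d_\theta(y,x)$; $d_\theta(x,y)\le\theta(d_\theta(x,z),d_\theta(z,y))$. Then $(X,d_\theta)$ is called a $\theta$-metric space. For $x\in X$ and $r\in \mathrm{Im}(\theta)$ put $B_{d_\theta}(x,r)=\{y\in X: d_\theta(x,y)<r\}$. The induced topology $\tau_{d_\theta}$ on $X$ consists of all $A\subset X$ such that for every $x\in A$ there is $r\in \mathrm{Im}(\theta)\setminus\{0\}$ with $B_{d_\theta}(x,r)\subset A$. Convergence of sequences in $X$ is with respect to $\tau_{d_\theta}$. A sequence $\{x_n\}$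 in $X$ is Cauchy if for each $\epsilon>0$ there is $N>0$ such that $d_\theta(x_n,x_m)<\epsilon$ for all $m\ge n\ge N$. The space $(X,d_\theta)$ is complete if every Cauchy sequence converges in $X$. *)

(* Defs.v *)
From HB Require Import structures.
From mathcomp Require Import all_boot all_order all_algebra.
From mathcomp Require Import all_classical all_reals all_analysis.

Set Implicit Arguments.
Unset Strict Implicit.
Unset Printing Implicit Defensive.

Import Order.TTheory GRing.Theory Num.Theory.
Import numFieldNormedType.Exports.

Local Open Scope classical_set_scope.
Local Open Scope ring_scope.

(* A map [0, +oo) x [0, +oo) -> [0, +oo) is encoded as a map R -> R -> R whose
   values at negative arguments are irrelevant: every condition below is
   restricted to nonnegative arguments. *)

Definition theta_im (R : realType) (theta : R -> R -> R) : set R :=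
  [set r | exists s t : R, [/\ 0 <= s, 0 <= t & theta s t = r]].

Record B_action (R : realType) (theta : R -> R -> R) : Prop := BAction {
  theta_ge0 : forall s t : R, 0 <= s -> 0 <= t -> 0 <= theta s t ;
  theta_continuousl : forall t : R, 0 <= t ->
    {within `[0, +oo[, continuous (fun s : R => theta s t)} ;
  theta_continuousr : forall s : R, 0 <= s ->
    {within `[0, +oo[, continuous (fun t : R => theta s t)} ;
  theta00 : theta 0 0 = 0 ;
  thetaC : forall s t : R, 0 <= s -> 0 <= t -> theta t s = theta s t ;
  theta_lt : forall s t u v : R, 0 <= s -> 0 <= t -> 0 <= u -> 0 <= v ->
    (s < u /\ t <= v) \/ (s <= u /\ t < v) -> theta s t < theta u v ;
  theta_solve : forall r s : R, theta_im theta r -> r <> 0 -> 0 < s <= r ->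
    exists2 t : R, 0 <= t <= r & theta t s = r ;
  theta_le : forall s : R, 0 < s -> theta s 0 <= s
}.

Record theta_metric (R : realType) (theta : R -> R -> R) (X : Type)
    (d : X -> X -> R) : Prop := ThetaMetric {
  theta_metric_ge0 : forall x y, 0 <= d x y ;
  theta_metric_eq0 : forall x y, d x y = 0 <-> x = y ;
  theta_metric_sym : forall x y, d x y = d y x ;
  theta_metric_triangle : forall x y z, d x y <= theta (d x z) (d z y)
}.

Definition dist_ball (R : realType) (X : Type) (d : X -> X -> R) (x : X)
  (r : R) : set X := [set y | d x y < r].

Definition theta_open (R : realType) (theta : R -> R -> R) (X : Type)
    (d : X -> X -> R) : set_system X :=
  [set A | forall x, A x ->
    exists2 r, (theta_im theta `\ 0) r & dist_ball d x r `<=` A].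

Section theta_topology.
Context (R : realType) (theta : R -> R -> R) (X : Type) (d : X -> X -> R).

Lemma theta_openT : B_action theta -> theta_open theta d setT.
Proof.
move=> ht x _; exists (theta 1 1) => //; split.
  by exists 1, 1; split.
move=> /= t11; have := theta_lt ht (lexx 0) (lexx 0) ler01 ler01.
by rewrite (theta00 ht) t11 ltxx => /(_ (or_introl (conj ltr01 ler01))).
Qed.

Lemma theta_openI : setI_closed (theta_open theta d).
Proof.
move=> A B oA oB x [/oA[r rim rA] /oB[s sim sB]].
have [rs|sr] := leP r s.
  exists r => // y xy; split; first exact: rA.
  by apply: sB; exact: lt_le_trans xy rs.
exists s => // y xy; split; last exact: sB.
by apply: rA; exact: lt_trans xy sr.
Qed.

Lemma theta_open_bigU (I : Type) (f : I -> set X) :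
  (forall i, theta_open theta d (f i)) -> theta_open theta d (\bigcup_i f i).
Proof.
move=> of_ x [i _ /of_[r rim rf]]; exists r => //.
by apply: subset_trans rf _; exact: bigcup_sup.
Qed.

End theta_topology.

(* The carrier X equipped with the topology theta_open theta d *)
Definition theta_space (R : realType) (theta : R -> R -> R) (X : Type)
  (d : X -> X -> R) (htheta : B_action theta) (hd : theta_metric theta d)
  : Type := X.

Section theta_space_topology.
Context (R : realType) (theta : R -> R -> R) (X : Type) (d : X -> X -> R).
Context (htheta : B_action theta) (hd : theta_metric theta d).

HB.instance Definition _ := gen_eqMixin (theta_space htheta hd).
HB.instance Definition _ := gen_choiceMixin (theta_space htheta hd).
HB.instance Definition _ := isOpenTopological.Build (theta_space htheta hd)
  (theta_openT d htheta) (@theta_openI R theta X d)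
  (@theta_open_bigU R theta X d).

Lemma open_theta_space :
  (open : set_system (theta_space htheta hd)) = theta_open theta d.
Proof. by []. Qed.

End theta_space_topology.

Definition cauchy_seq (R : realType) (X : Type) (d : X -> X -> R)
    (u : nat -> X) : Prop :=
  forall e : R, 0 < e -> exists2 N, (0 < N)%N &
    forall n m, (N <= n <= m)%N -> d (u n) (u m) < e.

Definition complete_dist (R : realType) (T : topologicalType)
    (d : T -> T -> R) : Prop :=
  forall u : nat -> T, cauchy_seq d u -> exists l : T, u @ \oo --> l.

Record is_metric (R : realType) (X : Type) (d : X -> X -> R) : Prop :=
  IsMetric {
  is_metric_ge0 : forall x y, 0 <= d x y ;
  is_metric_eq0 : forall x y, d x y = 0 <-> x = y ;
  is_metric_sym : forall x y, d x y = d y x ;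
  is_metric_triangle : forall x y z, d x y <= d x z + d z y
}.

(* The carrier X equipped with the library's metricType structure for d *)
Definition metric_space (R : realType) (X : choiceType) (d : X -> X -> R)
  (hd : is_metric d) : Type := X.

Section metric_space_structure.
Context (R : realType) (X : choiceType) (d : X -> X -> R) (hd : is_metric d).

Let mdistxx x : d x x = 0.
Proof. exact/(is_metric_eq0 hd). Qed.

Let mdist_positivity x y : d x y = 0 -> x = y.
Proof. by move/(is_metric_eq0 hd). Qed.

Let mdist_triangle y x z : d x z <= d x y + d y z.
Proof. exact: is_metric_triangle hd x z y. Qed.

HB.instance Definition _ := Choice.on (metric_space hd).
HB.instance Definition _ := isMetric.Build R (metric_space hd)
  mdistxx mdist_positivity (is_metric_sym hd) mdist_triangle.

Lemma mdist_metric_space (x y : metric_space hd) : mdist x y = d x y.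
Proof. by []. Qed.

End metric_space_structure.

Definition completely_metrizable (R : realType) (T : topologicalType) : Prop :=
  exists (rho : T -> T -> R) (hrho : is_metric rho),
    (forall A : set T, @open (metric_space hrho) A <-> open A) /\
    @complete_dist R (metric_space hrho) mdist.

(* Main.v *)
(* Since theta s 0 <= s and theta is continuous in each variable and increasing,
   theta(s, t) is small as soon as s and t are.  Hence the sets
   {(x, y) | d x y < e} form a countable base of a separated uniformity on X,
   which is induced by a metric rho by the classical metrization theorem for
   uniform spaces.  As rho and d are uniformly equivalent, they have the same
   Cauchy sequences, and they have the same open sets because Im(theta) contains
   arbitrarily small positive numbers. *)
Require Import Defs.
From HB Require Import structures.
From mathcomp Require Import all_boot all_order all_algebra.
From mathcomp Require Import all_classical all_reals all_analysis.

Set Implicit Arguments.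
Unset Strict Implicit.
Unset Printing Implicit Defensive.

Import Order.TTheory GRing.Theory Num.Theory.
Import numFieldNormedType.Exports.

Local Open Scope classical_set_scope.
Local Open Scope ring_scope.

Section uniform_metrization.
Context (R : realType) (T : uniformType) (cT : countable_uniformity T).
Hypothesis entourage_separated : forall x y : T,
  (forall E, entourage E -> E (x, y)) -> x = y.

Let M : pseudoMetricType R := countable_uniform cT.

Let radii (x y : M) : set R := [set e | 0 < e /\ ball x e y].

(** The structure on [M] is given by its balls, so a real-valued distance is extracted from the
    admissible radii. The infimum need not be attained, which is why the next two lemmas mix strict
    and large inequalities. *)
Definition inf_radius (x y : T) : R := inf (radii x y).

Let radii_neq0 x y : radii x y !=set0.
Proof.
(* In [M] every ball of radius 2 is the whole space, so [inf] never takes its default value. *)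
by exists 2; split=> //; exact: countable_uniform.countable_uniform_bounded.
Qed.

Let radii_lb0 x y : lbound (radii x y) 0.
Proof. by move=> e [/ltW]. Qed.

Let radii_has_lbound x y : has_lbound (radii x y).
Proof. by exists 0; exact: radii_lb0. Qed.

Lemma inf_radius_lt (x y : T) (e : R) :
  inf_radius x y < e -> @ball R M x e y.
Proof.
move=> /(inf_lt (radii_neq0 x y))[r [r0 xry] re].
by apply: le_ball xry; exact: ltW.
Qed.

Lemma inf_radius_le (x y : T) (e : R) :
  0 < e -> @ball R M x e y -> inf_radius x y <= e.
Proof. by move=> e0 xey; apply: ge_inf. Qed.

Lemma inf_radius_metric : is_metric inf_radius.
Proof.
have ge0 x y : 0 <= inf_radius x y by apply: lb_le_inf.
split=> // x y.
- split=> [xy0|->].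
    apply: entourage_separated => E.
    rewrite -[entourage]/(@entourage M) -entourage_ballE => -[e /= e0]; apply.
    by apply: inf_radius_lt; rewrite xy0.
  apply/eqP; rewrite eq_le ge0 andbT; apply/ler_addgt0Pl => e e0.
  by rewrite addr0; apply: inf_radius_le => //; exact: ballxx.
- by congr inf; apply/seteqP; split=> e [e0 /ball_sym].
(* Each of the two distances is enlarged by [e / 2] to become a genuine radius. *)
- move=> z; apply/ler_addgt0Pl => e e0.
  rewrite addrC (splitr e) addrACA; apply: inf_radius_le.
    by rewrite addr_gt0 // ltr_wpDl ?divr_gt0.
  by apply: (@ball_triangle R M z); apply: inf_radius_lt;
    rewrite ltrDl divr_gt0.
Qed.

Lemma entourage_inf_radius :
  entourage_ (dist_ball inf_radius) = @entourage T.
Proof.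
rewrite -[RHS]/(@entourage M) -entourage_ballE; apply/seteqP.
split=> E [e /= e0 eE].
  (* A ball of radius [e / 2] only gives [inf_radius x y <= e / 2]; halving restores the strict
     bound. *)
  exists (e / 2); first by rewrite /= divr_gt0.
  move=> [x y] /= xy; apply: eE => /=.
  apply: (@le_lt_trans _ _ (e / 2)); last by rewrite gtr_pMr// invf_lt1// ltr1n.
  by apply: inf_radius_le => //; rewrite divr_gt0.
by exists e => // -[x y] /inf_radius_lt /= xy; exact: eE.
Qed.

End uniform_metrization.

(** The proofs are parameters so that a uniform structure can be attached to this copy of [X]. The
    condition [d_split] stands in for the triangle inequality and is what splits entourages. *)
Definition dist_uniform (R : realType) (X : choiceType) (d : X -> X -> R)
  (d_refl : forall x, d x x = 0) (d_sym : forall x y, d x y = d y x)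
  (d_split : forall e, 0 < e -> exists2 r, 0 < r &
    forall x y z, d x z < r -> d z y < r -> d x y < e) : Type := X.

Section dist_uniform_structure.
Context (R : realType) (X : choiceType) (d : X -> X -> R).
Hypothesis d_refl : forall x, d x x = 0.
Hypothesis d_sym : forall x y, d x y = d y x.
Hypothesis d_split : forall e, 0 < e -> exists2 r, 0 < r &
  forall x y z, d x z < r -> d z y < r -> d x y < e.

Let U : Type := dist_uniform d_refl d_sym d_split.
Let ent : set_system (U * U) := entourage_ (dist_ball d).

Let ent_filter : Filter ent.
Proof.
apply: filter_from_filter; first by exists 1 => /=.
move=> e r /= e0 r0; exists (Num.min e r) => /=; first by rewrite lt_min e0.
by move=> [x y]; rewrite /dist_ball /= lt_min => /andP[].
Qed.

Let ent_diagonal A : ent A -> diagonal `<=` A.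
Proof.
by move=> [e e0 eA] [x y] /diagonalP <-; apply: eA; rewrite /dist_ball /= d_refl.
Qed.

Let ent_inv A : ent A -> ent A^-1%relation.
Proof.
move=> [e e0 eA]; exists e => // -[x y] xy.
by apply: eA; rewrite /dist_ball /= d_sym.
Qed.

Let ent_split A : ent A -> exists2 B, ent B & (B \; B)%relation `<=` A.
Proof.
move=> [e /d_split[r r0 re] eA].
exists [set xy | dist_ball d xy.1 r xy.2]; first by exists r.
by move=> [x y] [z xz zy]; apply: eA; exact: re xz zy.
Qed.

HB.instance Definition _ := Choice.on U.
HB.instance Definition _ := isUniform.Build U
  ent_filter ent_diagonal ent_inv ent_split.

Lemma dist_uniform_countable : countable_uniformity (U : uniformType).
Proof.
apply/countable_uniformityP.
exists (fun n => [set xy | dist_ball d xy.1 n.+1%:R^-1 xy.2]); last first.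
  by move=> n; exists n.+1%:R^-1 => //=; rewrite invr_gt0.
(* With [n = truncn e^-1] one has [e^-1 < n + 1], hence [(n + 1)^-1 <= e]. *)
move=> E [e /= e0 eE]; exists (Num.truncn e^-1) => -[x y] xy.
apply: eE; apply: lt_le_trans xy _.
by rewrite -[leRHS]invrK lef_pV2 ?posrE ?invr_gt0// ltW// truncnS_gt.
Qed.

End dist_uniform_structure.


Lemma entourage_dist_le (R : realType) (X : Type) (d1 d2 : X -> X -> R) (e : R) :
  entourage_ (dist_ball d1) `<=` entourage_ (dist_ball d2) ->
  0 < e -> exists2 r, 0 < r & forall x y, d2 x y < r -> d1 x y < e.
Proof.
move=> d12 e0.
have /d12[r r0 re] :
  entourage_ (dist_ball d1) [set xy | dist_ball d1 xy.1 e xy.2] by exists e.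
by exists r => // x y xy; exact: (re (x, y)).
Qed.

Lemma dist_metrization (R : realType) (X : choiceType) (d : X -> X -> R) :
  (forall x y, 0 <= d x y) -> (forall x y, d x y = 0 <-> x = y) ->
  (forall x y, d x y = d y x) ->
  (forall e, 0 < e -> exists2 r, 0 < r &
    forall x y z, d x z < r -> d z y < r -> d x y < e) ->
  exists2 rho : X -> X -> R, is_metric rho &
    entourage_ (dist_ball rho) = entourage_ (dist_ball d).
Proof.
move=> d_ge0 d_eq0 d_sym d_split.
have d_refl x : d x x = 0 by apply/d_eq0.
pose cU := dist_uniform_countable d_refl d_sym d_split.
exists (@inf_radius R _ cU); last exact: (@entourage_inf_radius R _ cU).
(* Separation: a pair lying in every entourage satisfies [d x y < e] for all [e > 0]. *)
apply: (@inf_radius_metric R _ cU) => x y xy; apply/d_eq0/eqP.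
rewrite eq_le d_ge0 andbT; apply/ler_addgt0Pl => e e0.
have /xy : @entourage (dist_uniform d_refl d_sym d_split)
  [set xy | dist_ball d xy.1 e xy.2] by exists e.
by rewrite addr0 => /ltW.
Qed.

(** Separate continuity suffices: [theta (e / 2) 0 <= e / 2 < e], right continuity of
    [theta (e / 2)] at 0 yields one further point where the value stays below [e], and monotonicity
    bounds [theta] on the whole rectangle below it. *)
Lemma B_action_small (R : realType) (theta : R -> R -> R) (e : R) :
  B_action theta -> 0 < e ->
  exists2 r, 0 < r & forall s t, 0 <= s < r -> 0 <= t < r -> theta s t < e.
Proof.
move=> ht e0; have e2 : 0 < e / 2 by rewrite divr_gt0.
have te : theta (e / 2) 0 < e.
  by apply: le_lt_trans (theta_le ht e2) _; rewrite gtr_pMr// invf_lt1// ltr1n.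
have /continuous_within_itvcyP[_] := theta_continuousr ht (ltW e2).
move=> /cvgr_lt/(_ _ te)[r /= r0 rt].
exists (Num.min (e / 2) (r / 2)); first by rewrite lt_min e2 divr_gt0.
move=> s t /andP[s0]; rewrite lt_min => /andP[se _].
move=> /andP[t0]; rewrite lt_min => /andP[_ tr].
have r2 : 0 < r / 2 by rewrite divr_gt0.
have : theta (e / 2) (r / 2) < e.
  apply: rt => //=.
  by rewrite sub0r normrN gtr0_norm// gtr_pMr// invf_lt1// ltr1n.
by apply: lt_trans; apply: (theta_lt ht) => //; [exact: ltW|exact: ltW|];
  left; split=> //; exact: ltW.
Qed.

(** The value [theta e 0] works: it is positive by strict monotonicity and at most [e] by
    [theta_le]. *)
Lemma theta_im_small (R : realType) (theta : R -> R -> R) (e : R) :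
  B_action theta -> 0 < e ->
  exists2 r, (theta_im theta `\ 0) r & 0 < r <= e.
Proof.
move=> ht e0.
have te0 : 0 < theta e 0.
  rewrite -[X in X < _](theta00 ht); apply: (theta_lt ht) => //; first exact: ltW.
  by left.
exists (theta e 0); last by rewrite te0 (theta_le ht).
split; first by exists e, 0; split=> //; exact: ltW.
by move=> /= te; rewrite te ltxx in te0.
Qed.

(** Frees the radii from the image of [theta], so that openness takes the same form as in
    [open_metric_spaceP]. *)
Lemma theta_openP (R : realType) (theta : R -> R -> R) (X : Type)
    (d : X -> X -> R) (A : set X) : B_action theta ->
  theta_open theta d A <->
  forall x, A x -> exists2 e, 0 < e & dist_ball d x e `<=` A.
Proof.
move=> ht; split=> oA x /oA[r].
  move=> [[s [t [s0 t0 <-]]] /= /eqP st] stA; exists (theta s t) => //.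
  by rewrite lt_neqAle eq_sym st (theta_ge0 ht).
move=> /(theta_im_small ht)[e im_e /andP[_ er]] rA.
by exists e => // y xy; apply: rA; exact: lt_le_trans xy er.
Qed.

Lemma open_metric_spaceP (R : realType) (X : choiceType) (d : X -> X -> R)
    (hd : is_metric d) (A : set X) :
  @open (metric_space hd) A <->
  forall x, A x -> exists2 e, 0 < e & dist_ball d x e `<=` A.
Proof.
rewrite openE; split=> oA x /oA; first by move=> /nbhs_ballP[e /= e0 eA]; exists e.
by move=> [e e0 eA]; apply/nbhs_ballP; exists e.
Qed.

Theorem theorem2p5 (R : realType) (theta : R -> R -> R) (X : Type)
    (d : X -> X -> R) (hX : inhabited X)
    (htheta : B_action theta) (hd : theta_metric theta d) :
  @complete_dist R (theta_space htheta hd) d ->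
  completely_metrizable R (theta_space htheta hd).
Proof.
move=> d_complete.
have d_split e : 0 < e -> exists2 r, 0 < r &
    forall x y z, d x z < r -> d z y < r -> d x y < e.
  move=> /(B_action_small htheta)[r r0 re]; exists r => // x y z xz zy.
  apply: le_lt_trans (theta_metric_triangle hd x y z) _.
  by apply: re; rewrite (theta_metric_ge0 hd).
(* [X] is a bare type; its copy [theta_space htheta hd] carries the required choice structure. *)
have [rho hrho rhod] := @dist_metrization R (theta_space htheta hd) d
  (theta_metric_ge0 hd) (theta_metric_eq0 hd) (theta_metric_sym hd) d_split.
have small_d e : 0 < e ->
    exists2 r, 0 < r & forall x y, d x y < r -> rho x y < e.
  by apply: entourage_dist_le; rewrite rhod.
have small_rho e : 0 < e ->
    exists2 r, 0 < r & forall x y, rho x y < r -> d x y < e.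
  by apply: entourage_dist_le; rewrite rhod.
have open_rhoE (A : set (theta_space htheta hd)) :
    @open (metric_space hrho) A <-> open A.
  rewrite open_theta_space theta_openP// open_metric_spaceP.
  split=> oA x /oA[e].
    by move=> /small_d[r r0 re] eA; exists r => // y /re; exact: eA.
  by move=> /small_rho[r r0 re] eA; exists r => // y /re; exact: eA.
exists rho, hrho; split=> // u u_cauchy.
have [|l ul] := d_complete u.
  move=> e /small_rho[r r0 re]; have [N N0 uN] := u_cauchy r r0.
  by exists N => // n m /uN; exact: re.
(* The limit [l] is one for the topology of [d]; it transfers to [rho] through open
   neighbourhoods. *)
exists l => A; rewrite nbhsE => -[B [oB Bl] BA].
apply: (ul A); rewrite nbhsE; exists B => //; split=> //.
exact/open_rhoE.
Qed.
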